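(* Let $f:X\to X$ be a continuous map of a compact metric space, and let $\{\mathcal G_k\}$ be a collection of grids for $X$, partially ordered by refinement. For each $k$, let $\mathcal F^{\mathcal G_k}:\mathcal G_k\rightrightarrows\mathcal G_k$ be the minimal multivalued map associated to $f$ on $\mathcal G_k$. Then for every $\mathcal G_{k_1}<\mathcal G_{k_2}$ there is a grid map morphism $h_{k_1}^{k_2}:\mathcal G_{k_1}\to\mathcal G_{k_2}$ (from $\mathcal F^{\mathcal G_{k_1}}$ to $\mathcal F^{\mathcal G_{k_2}}$), and if $\mathcal G_{k_1}<\mathcal G_{k_2}<\mathcal G_{k_3}$, then $h_{k_2}^{k_3}\circ h_{k_1}^{k_2}=h_{k_1}^{k_3}$.
   Context: A grid $\mathcal G$ on a compact metric space $X$ is a finite collection of nonempty compact subsets of $X$ such that (1) $X=\bigcup_{G\in\mathcal G}G$; (2) $G=\operatorname{cl}(\operatorname{int}(G))$ for all $G\in\mathcal G$; (3) $G\cap\operatorname{int}(H)=\emptyset$ for all $G\ne H$ in $\mathcal G$. For grids $\mathcal G,\mathcal G'$ on $X$, $\mathcal G$ refines $\mathcal G'$, written $\mathcal G<\mathcal G'$, if for every $G\in\mathcal G$ there is $G'\in\mathcal G'$ with $G\subset G'$. A multivalued map $\mathcal F:\mathcal G\rightrightarrows\mathcal G$ assigns to each $G\in\mathcal G$ a subset $\mathcal F(G)\subset\mathcal G$; it is identified with the directed graph with vertex set $\mathcal G$ and an edge $G\to H$ whenever $H\in\mathcal F(G)$. The minimal multivalued map associated to $f$ on $\mathcal G$ is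 $\mathcal F^{\mathcal G}(G):=\{H\in\mathcal G: H\cap f(G)\neq\emptyset\}$. Given multivalued maps $\mathcal F:\mathcal G\rightrightarrows\mathcal G$ and $\mathcal F':\mathcal G'\rightrightarrows\mathcal G'$, a (single-valued) map $h:\mathcal G\to\mathcal G'$ is a grid map morphism if $h(\mathcal F(G))\subset\mathcal F'(h(G))$ for all $G\in\mathcal G$ (equivalently, $h$ is a directed graph homomorphism from $\mathcal F$ to $\mathcal F'$). *)

(* Defs.v *)
From HB Require Import structures.
From mathcomp Require Import all_boot all_order all_algebra.
From mathcomp Require Import all_classical all_reals.
From mathcomp Require Import topology normedtype.

Set Implicit Arguments.
Unset Strict Implicit.
Unset Printing Implicit Defensive.

Local Open Scope classical_set_scope.

(* Only the topology of X enters the definition; compactness of X itself is a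
   hypothesis of the theorem.  Through the coercions to set (set X) and then to
   set_type, a grid G used as a type is {A : set X | A \in grid_elements G}. *)
Record grid (X : topologicalType) := Grid {
  grid_elements :> set (set X) ;
  grid_finite : finite_set grid_elements ;
  grid_nonempty : forall A, grid_elements A -> A !=set0 ;
  grid_compact : forall A, grid_elements A -> compact A ;
  grid_cover : \bigcup_(A in grid_elements) A = [set: X] ;
  grid_regclosed : forall A, grid_elements A -> regclosed A ;
  grid_disjoint : forall A B, grid_elements A -> grid_elements B ->
    A <> B -> A `&` interior B = set0 }.

Definition refines (X : topologicalType) (G G' : grid X) : Prop :=
  forall A : G, exists A' : G', val A `<=` val A'.

Definition multimap (X : topologicalType) (G : grid X) : Type := G -> set G.

Definition minimal_multimap (X : topologicalType) (f : X -> X) (G : grid X) :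
    multimap G :=
  fun A => [set B : G | val B `&` f @` val A !=set0].
Arguments minimal_multimap {X} f G.

Definition grid_morphism (X : topologicalType) (G G' : grid X)
    (F : multimap G) (F' : multimap G') (h : G -> G') : Prop :=
  forall A : G, h @` F A `<=` F' (h A).

(* Main.v *)
(** Every element A of a grid has nonempty interior, since A = cl(int A) is
    nonempty.  So A lies in at most one element of any other grid: if A is
    contained in distinct B and C, then int A lies in B and in int C, which are
    disjoint.  Hence h(A) := "the element containing A" is well defined, and
    uniqueness makes it functorial. *)
Require Import Defs.
From HB Require Import structures.
From mathcomp Require Import all_boot all_order all_algebra.
From mathcomp Require Import all_classical all_reals.
From mathcomp Require Import topology normedtype.

Set Implicit Arguments.
Unset Strict Implicit.
Unset Printing Implicit Defensive.

Local Open Scope classical_set_scope.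

Lemma grid_interior_nonempty (X : topologicalType) (G : grid X) (A : set X) :
  grid_elements G A -> A° !=set0.
Proof.
move=> GA; apply/set0P/eqP => intA0.
have [x] := grid_nonempty GA.
by rewrite -(grid_regclosed GA) intA0 closure0.
Qed.

Lemma grid_superset_unique (X : topologicalType) (G G' : grid X) (A : set X)
    (B C : G') :
  grid_elements G A -> A `<=` val B -> A `<=` val C -> B = C.
Proof.
move=> GA AB AC; apply/val_inj; apply: contrapT => BC.
have [x Ax] := grid_interior_nonempty GA.
have := grid_disjoint (set_mem (valP B)) (set_mem (valP C)) BC.
rewrite -subset0; apply; split; last exact: interiorS AC _ Ax.
exact: AB (interior_subset Ax).
Qed.

Theorem proposition4p2 (R : realType) (X : metricType R)
    (compactX : compact [set: X]) (f : X -> X) (contf : continuous f)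
    (K : Type) (G : K -> grid X) :
  exists h : forall k1 k2 : K, refines (G k1) (G k2) -> G k1 -> G k2,
    (forall (k1 k2 : K) (r12 : refines (G k1) (G k2)),
       grid_morphism (minimal_multimap f (G k1)) (minimal_multimap f (G k2))
         (h k1 k2 r12)) /\
    (forall (k1 k2 k3 : K) (r12 : refines (G k1) (G k2))
            (r23 : refines (G k2) (G k3)) (r13 : refines (G k1) (G k3)),
       h k2 k3 r23 \o h k1 k2 r12 = h k1 k3 r13).
Proof.
(* [cid] picks one superset of [A]. The pick may a priori vary with the proof [r12]; uniqueness
   makes this harmless. *)
have r_ex k1 k2 (r12 : refines (G k1) (G k2)) (A : G k1) :
  {A' : G k2 | val A `<=` val A'} := cid (r12 A).
exists (fun k1 k2 r12 A => sval (r_ex k1 k2 r12 A)); split.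
  move=> k1 k2 r12 A _ [B [y [By [x Ax fx]]] <-].
  (* The same [y], equal to [f x], witnesses the edge from h(A) to h(B), since A lies in h(A) and B
     in h(B). *)
  exists y; split; first exact: (svalP (r_ex _ _ r12 B)).
  by exists x => //; exact: (svalP (r_ex _ _ r12 A)).
move=> k1 k2 k3 r12 r23 r13; apply/funext => A /=.
(* Both sides are elements of [G k3] containing [A], the composite by transitivity of inclusion. *)
apply: (grid_superset_unique (set_mem (valP A))); last first.
  exact: (svalP (r_ex _ _ r13 A)).
by apply: subset_trans (svalP (r_ex _ _ r12 A)) (svalP (r_ex _ _ r23 _)).
Qed.
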